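(* Let $(V,P)$ be a finite, irreducible, reversible Markov chain with reversible probability measure $m$ (so $m(V)=1$). Then \[ \tfrac14\,\alpha_{\operatorname{cap}}^\theta \;\le\; \alpha_{\operatorname{spectral}} \;\le\; 2\,\alpha_{\operatorname{cap}}^\theta . \]
   Context: $V$ is a finite set, $P:V\times V\to[0,\infty)$ has symmetric support ($P(x,y)>0\iff P(y,x)>0$), the chain is connected, and $m$ is a probability measure on $V$ with $m(x)P(x,y)=m(y)P(y,x)$ for all $x,y$. The Laplacian is $\Delta f(x)=\sum_y P(x,y)(f(y)-f(x))$, the inner product is $\langle f,g\rangle=\sum_x f(x)g(x)m(x)$, $\|f\|_2=\langle f,f\rangle^{1/2}$, and the Dirichlet form is $\mathcal E(f,g)=-\langle \Delta f,g\rangle$, $\mathcal E(f)=\mathcal E(f,f)$. For disjoint nonempty $A,B\subset V$, $\operatorname{cap}(A,B)=\min\{\mathcal E(f): f|_A=0,\ f|_B=1\}$. The logarithmic mean is $\theta(s,t)=(s-t)/(\log s-\log t)$ for $s\ne t$ and $\theta(s,s)=s$. Define $\alpha_{\operatorname{cap}}^\theta=\inf_{A,B}\theta\big(\operatorname{cap}(A,B)/m(A),\operatorname{cap}(A,B)/m(B)\big)$ over disjoint nonempty $A,B\subset V$. For nonempty $X\subsetneq V$, $\lambda_X=\inf\{\mathcal E(f,f):\|f\|_2=1,\ f|_{V\setminus X}=0\}$, and $\alpha_{\operatorname{spectral}}=\inf_{X}\theta(\lambda_X,\lambda_{V\setminus X})$ over nonempty proper subsets $X\subset V$. *)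

(* Defs.v *)
From HB Require Import structures.
From mathcomp Require Import all_boot all_order all_algebra.
From mathcomp Require Import classical_sets reals exp.
Set Implicit Arguments. Unset Strict Implicit. Unset Printing Implicit Defensive.
Import Order.TTheory GRing.Theory Num.Theory.
Local Open Scope ring_scope.

Definition logmean {R : realType} (s t : R) : R :=
  if s == t then s else (s - t) / (ln s - ln t).

Section Defs.
Variables (R : realType) (V : finType) (P : V -> V -> R) (m : V -> R).

Definition laplacian (f : V -> R) (x : V) : R := \sum_(y : V) P x y * (f y - f x).

Definition inner (f g : V -> R) : R := \sum_(x : V) f x * g x * m x.

Definition norm2 (f : V -> R) : R := Num.sqrt (inner f f).

Definition dirichlet (f g : V -> R) : R := - inner (laplacian f) g.

Definition measure_of (A : {set V}) : R := \sum_(x in A) m x.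

(* cap(A,B) = min { E(f) : f|_A = 0, f|_B = 1 } (the minimum is attained; taken as inf) *)
Definition cap (A B : {set V}) : R :=
  inf [set dirichlet f f | f in [set f : V -> R |
        (forall x, x \in A -> f x = 0) /\ (forall x, x \in B -> f x = 1)]%classic]%classic.

Definition lambda (X : {set V}) : R :=
  inf [set dirichlet f f | f in [set f : V -> R |
        norm2 f = 1 /\ (forall x, x \notin X -> f x = 0)]%classic]%classic.

Definition cap_theta_values : set R := fun t =>
  exists A B : {set V},
    [/\ A != finset.set0, B != finset.set0, [disjoint A & B] &
        t = logmean (cap A B / measure_of A) (cap A B / measure_of B)].

Definition alpha_cap_theta : R := inf cap_theta_values.

Definition spectral_theta_values : set R := fun t =>
  exists X : {set V},
    [/\ X != finset.set0, X != finset.setT & t = logmean (lambda X) (lambda (~: X))].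

Definition alpha_spectral : R := inf spectral_theta_values.

End Defs.

(* Main.v *)
Require Import Defs.
From HB Require Import structures.
From mathcomp Require Import all_boot all_order all_algebra ring lra.
From mathcomp Require Import boolp classical_sets reals exp.
Import Order.TTheory GRing.Theory Num.Theory.
Local Open Scope ring_scope.

(** Write e for the potential of a pair (A, B): e = 0 on A, e = 1 on B, harmonic
elsewhere, so that cap(A, B) = E(e).

Upper bound: the truncation g = (e - 1/2)^+ equals 1/2 on B and satisfies
E(g) <= E(g, e) = cap(A, B) / 2, because E(g, e) only sees g on B; hence
lambda_X <= 2 cap(A, B) / m(B) for X = {e > 1/2}, and 1 - e gives the same for
the complement and A.

Lower bound: by Hansson's proof of the strong capacitary inequality, if
c m(A) <= cap(V \ X, A) for all A in X, then c ||f||^2 <= 4 E(f) for f supported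
in X. Choosing A in X and B in V \ X that minimize cap(V \ X, A) / m(A) and
cap(X, B) / m(B), one has cap(A, B) <= cap(V \ X, A) and cap(A, B) <= cap(X, B).

Both bounds pass to theta, which is monotone and homogeneous. *)

(** * Bounds, monotonicity and homogeneity of the logarithmic mean *)

Section LogarithmicMean.
Variable R : realType.
Implicit Types a b c s t : R.

Lemma logmeanC s t : logmean s t = logmean t s.
Proof.
rewrite /logmean eq_sym; case: eqP => [->//|_].
by rewrite -(opprB t s) -(opprB (ln t)) invrN mulrNN.
Qed.

Lemma logmean_lt a b : a < b -> logmean a b = (b - a) / (ln b - ln a).
Proof. by move=> ab; rewrite logmeanC /logmean gt_eqF. Qed.

Lemma ln_diff_gt0 a b : 0 < a -> a < b -> 0 < ln b - ln a.
Proof.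
by move=> a0 ab; rewrite subr_gt0 ltr_ln ?posrE ?(lt_trans a0 ab).
Qed.

(** Both bounds come from [ln (1 + x) <= x] at [x = t / s - 1]; the second is the first with the
    endpoints exchanged. *)
Lemma ln_diff_bounds a b : 0 < a -> 0 < b ->
  a * (ln b - ln a) <= b - a /\ b - a <= b * (ln b - ln a).
Proof.
have ub s t : 0 < s -> 0 < t -> s * (ln t - ln s) <= t - s.
  move=> s0 t0.
  have := @le_ln1Dx R (t / s - 1); rewrite ltrBrDl subrr divr_gt0// => /(_ isT).
  rewrite addrC subrK lnM ?lnV ?posrE ?invr_gt0// => h.
  apply: le_trans (ler_wpM2l (ltW s0) h) _.
  by rewrite mulrBr mulr1 mulrC divfK ?gt_eqF.
move=> a0 b0; split; first exact: ub.
by have := ub _ _ b0 a0; rewrite -[a - b]opprB -(opprB (ln b)) mulrN lerN2.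
Qed.

Lemma logmean_bounds a b : 0 < a -> a <= b -> a <= logmean a b <= b.
Proof.
rewrite le_eqVlt => a0 /orP[/eqP<-|ab]; first by rewrite /logmean eqxx lexx.
have l0 := ln_diff_gt0 _ _ a0 ab; rewrite logmean_lt//.
have [h1 h2] := ln_diff_bounds _ _ a0 (lt_trans a0 ab).
by rewrite ler_pdivlMr// ler_pdivrMr// h1.
Qed.

(* (c - a) / (ln c - ln a) is the mediant of the logarithmic means over [a, b]
   and [b, c], which are separated by b. *)
Lemma logmean_mediant a b c : 0 < a -> a < b -> b < c ->
  logmean a b <= logmean a c <= logmean b c.
Proof.
move=> a0 ab bc; have b0 := lt_trans a0 ab; have ac := lt_trans ab bc.
have l1 := ln_diff_gt0 _ _ a0 ab; have l2 := ln_diff_gt0 _ _ b0 bc.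
have l3 := ln_diff_gt0 _ _ a0 ac.
have [_ h1] := ln_diff_bounds _ _ a0 b0.
have [h2 _] := ln_diff_bounds _ _ b0 (lt_trans b0 bc).
rewrite !logmean_lt//; move: l1 l2 l3 h1 h2.
set p := ln b - ln a; set q := ln c - ln b => l1 l2.
have -> : ln c - ln a = p + q by rewrite /p /q; lra.
move=> l3 h1 h2; apply/andP; split.
  by rewrite ler_pdivrMr// mulrAC ler_pdivlMr//; nra.
by rewrite ler_pdivrMr// mulrAC ler_pdivlMr//; nra.
Qed.

Lemma logmean_monol a b t : 0 < a -> 0 < t -> a <= b -> logmean a t <= logmean b t.
Proof.
move=> a0 t0; rewrite le_eqVlt => /orP[/eqP->//|ab].
have b0 := lt_trans a0 ab.
(* Outside [[a, b]], the mediant bound applies to the three ordered points; inside, [t] itself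
   separates the two means. *)
have [bt|tb] := ltP b t.
  by have /andP[] := logmean_mediant _ _ _ a0 ab bt.
have [ta|at_] := ltP t a.
  by have /andP[h _] := logmean_mediant _ _ _ t0 ta ab; rewrite ![logmean _ t]logmeanC.
have /andP[_ h1] := logmean_bounds _ _ a0 at_.
have /andP[h2 _] := logmean_bounds _ _ t0 tb.
by rewrite (logmeanC b) (le_trans h1).
Qed.

Lemma logmean_mono a b s t : 0 < a -> 0 < s -> a <= b -> s <= t ->
  logmean a s <= logmean b t.
Proof.
move=> a0 s0 ab st; apply: (le_trans (logmean_monol _ _ _ a0 s0 ab)).
rewrite (logmeanC b s) (logmeanC b t).
by apply: logmean_monol => //; apply: lt_le_trans ab.
Qed.

Lemma logmean_ge0 s t : 0 < s -> 0 < t -> 0 <= logmean s t.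
Proof.
move=> s0 t0; have [st|/ltW ts] := leP s t.
  by have /andP[+ _] := logmean_bounds _ _ s0 st; apply/le_trans/ltW.
by have /andP[+ _] := logmean_bounds _ _ t0 ts; rewrite logmeanC; apply/le_trans/ltW.
Qed.

Lemma logmeanZ c s t : 0 < c -> 0 < s -> 0 < t ->
  logmean (c * s) (c * t) = c * logmean s t.
Proof.
move=> c0 s0 t0; rewrite /logmean (inj_eq (mulfI (lt0r_neq0 c0))).
case: eqP => // _; rewrite !lnM ?posrE// -mulrBr mulrA; congr (_ / _).
by rewrite opprD addrACA subrr add0r.
Qed.

End LogarithmicMean.

(** Finite dimension turns uniqueness for the Dirichlet problem into existence. *)
Lemma injective_linear_surjective {K : fieldType} {U : vectType K} {T : U -> U} :
  linear T -> injective T -> forall v, exists u, T u = v.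
Proof.
move=> linT injT v.
pose T' : {linear U -> U} := HB.pack T (GRing.isLinear.Build _ _ _ _ T linT).
have kerT : lker (linfun T') == 0%VS.
  by apply/lker0P => x y; rewrite !lfunE; apply: injT.
exists ((linfun T')^-1%VF v).
by have := lker0_lfunVK kerT v; rewrite lfunE.
Qed.

Lemma setC_eq0 (T : finType) (X : {set T}) :
  (~: X == finset.set0) = (X == finset.setT).
Proof. by rewrite -finset.setCT (inj_eq (@finset.setC_inj T)). Qed.

Section Chain.
Variables (R : realType) (V : finType) (P : V -> V -> R) (m : V -> R).
Hypothesis P_ge0 : forall x y, 0 <= P x y.
Hypothesis P_conn : forall x y, connect (fun u v => 0 < P u v) x y.
Hypothesis m_ge0 : forall x, 0 <= m x.
Hypothesis m_prob : \sum_(x : V) m x = 1.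
Hypothesis m_rev : forall x y, m x * P x y = m y * P y x.
Hypothesis P_symsupp : forall x y, (0 < P x y) = (0 < P y x).
Implicit Types (f g h e u : V -> R) (A B X : {set V}).
Local Notation E := (dirichlet P m).
Local Notation lap := (laplacian P).

(** * Connectedness and positivity of the measure *)

Lemma path_invariant (Q : V -> Prop) :
  (forall x y, 0 < P x y -> Q x -> Q y) -> forall x y, Q x -> Q y.
Proof.
move=> step x y Qx; have /connectP[p + ->] := P_conn x y.
by elim: p x Qx => //= z p IH x Qx /andP[/step xz]; apply/IH/xz.
Qed.

(** Some point has positive mass because the total is 1; reversibility and symmetric support carry
    positivity across each edge. *)
Lemma m_gt0 x : 0 < m x.
Proof.
have [y my|m0] := pickP (fun y => 0 < m y); last first.
  have : \sum_x m x = 0.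
    apply: big1 => y _; apply/eqP; rewrite eq_le m_ge0 andbT leNgt.
    by rewrite m0.
  by rewrite m_prob => /eqP; rewrite oner_eq0.
apply: (@path_invariant (fun z => 0 < m z) _ y) => // z w Pzw mz.
have : 0 < m w * P w z by rewrite -m_rev mulr_gt0.
by rewrite pmulr_lgt0// -P_symsupp.
Qed.

Lemma measure_gt0 A : A != finset.set0 -> 0 < measure_of m A.
Proof.
case/set0Pn => x xA; rewrite /measure_of (bigD1 x)//= ltr_pwDl ?m_gt0//.
exact: sumr_ge0.
Qed.

(** * Algebra and positivity of the Dirichlet form *)

(** By reversibility the two endpoints of each edge can be exchanged in the definition; averaging
    both expressions gives the symmetric form. *)
Lemma dirichletE f g :
  E f g = 2^-1 * \sum_(p : V * V) m p.1 * P p.1 p.2 *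
                    ((f p.2 - f p.1) * (g p.2 - g p.1)).
Proof.
have E1 : E f g = - \sum_x \sum_y m x * P x y * (f y - f x) * g x.
  rewrite /dirichlet /inner /laplacian; congr (- _); apply: eq_bigr => x _.
  by rewrite -mulrA mulr_suml; apply: eq_bigr => y _; ring.
have E2 : E f g = - \sum_x \sum_y m x * P x y * (f x - f y) * g y.
  rewrite E1 exchange_big; congr (- _); apply: eq_bigr => x _.
  by apply: eq_bigr => y _; rewrite m_rev.
have -> : E f g = 2^-1 * (E f g + E f g) by lra.
rewrite {1}E1 E2; congr (_ * _); rewrite -opprD -big_split -sumrN /=.
rewrite -(pair_bigA _ (fun x y => m x * P x y * ((f y - f x) * (g y - g x)))) /=.
apply: eq_bigr => x _; rewrite -big_split -sumrN /=.
by apply: eq_bigr => y _; ring.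
Qed.

Lemma dirichletC f g : E f g = E g f.
Proof. by rewrite !dirichletE; under eq_bigr do rewrite [_ * (_ - _)]mulrC. Qed.

Lemma dirichletDZl c f g h : E (fun x => f x + c * g x) h = E f h + c * E g h.
Proof.
rewrite !dirichletE [c * _]mulrCA -mulrDr (mulr_sumr _ _ _ c) -big_split; congr (_ * _).
by apply: eq_bigr => p _ /=; ring.
Qed.

Lemma dirichletDZ c f g :
  E (fun x => f x + c * g x) (fun x => f x + c * g x) =
  E f f + 2 * c * E f g + c ^+ 2 * E g g.
Proof.
rewrite dirichletDZl [E f _]dirichletC [E g _]dirichletC !dirichletDZl.
by rewrite (dirichletC g f); ring.
Qed.

Lemma dirichlet0 g : E (fun=> 0) g = 0.
Proof. by rewrite dirichletE big1 ?mulr0// => p _; rewrite subrr mul0r mulr0. Qed.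

(** Edge weights are nonnegative, so the energy bounds for truncations below reduce to one edge at a
    time. *)
Lemma le_dirichlet f g h k :
  (forall x y, (f y - f x) * (g y - g x) <= (h y - h x) * (k y - k x)) ->
  E f g <= E h k.
Proof.
move=> le; rewrite !dirichletE ler_pM2l ?invr_gt0//; apply: ler_sum => p _.
by rewrite ler_wpM2l ?mulr_ge0.
Qed.

Lemma eq_dirichlet f g h k :
  (forall x y, (f y - f x) * (g y - g x) = (h y - h x) * (k y - k x)) ->
  E f g = E h k.
Proof.
by move=> eq; apply: le_anti; rewrite !le_dirichlet// => x y; rewrite eq.
Qed.

Lemma dirichlet_ge0 f : 0 <= E f f.
Proof.
rewrite dirichletE mulr_ge0 ?invr_ge0//; apply: sumr_ge0 => p _.
by rewrite -expr2 mulr_ge0 ?sqr_ge0 ?mulr_ge0//.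
Qed.

Lemma dirichlet_eq0 f : E f f = 0 -> forall x y, f x = f y.
Proof.
move=> /eqP; rewrite dirichletE mulf_eq0 invr_eq0 pnatr_eq0 /= => /eqP f0 x y.
apply: (@path_invariant (fun z => f x = f z) _ x) => // z w Pzw ->.
have term_ge0 (p : V * V) :
    true -> 0 <= m p.1 * P p.1 p.2 * ((f p.2 - f p.1) * (f p.2 - f p.1)).
  by rewrite -expr2 mulr_ge0 ?sqr_ge0 ?mulr_ge0.
have /eqP := psumr_eq0P term_ge0 f0 (i := (z, w)) isT.
rewrite /= !mulf_eq0 (gt_eqF (m_gt0 z)) (gt_eqF Pzw) /= orbb subr_eq0.
by move=> h; apply/esym/eqP.
Qed.

(** * Equilibrium potentials *)

Definition equilibrium A B e : Prop :=
  [/\ forall x, x \in A -> e x = 0, forall x, x \in B -> e x = 1 &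
      forall x, x \notin A :|: B -> lap e x = 0].

Lemma equilibrium_exists A B : [disjoint A & B] -> A :|: B != finset.set0 ->
  exists e, equilibrium A B e.
Proof.
move=> dAB /set0Pn[x0 x0AB].
(* [T] keeps the values on [A :|: B] and takes the Laplacian elsewhere, so a preimage of the
   indicator of [B] is the potential. *)
pose T (f : {ffun V -> R^o}) : {ffun V -> R^o} :=
  [ffun x => if x \in A :|: B then f x else lap f x].
have linT : linear T.
  move=> c f g; apply/ffunP => x; rewrite !ffunE; case: ifP => // _.
  rewrite /laplacian scaler_sumr -big_split; apply: eq_bigr => y _.
  by rewrite !ffunE /GRing.scale /=; ring.
have injT : injective T.
  move=> f g Tfg; pose h (x : V) : R := f x + -1 * g x.
  have Th x : (if x \in A :|: B then h x else lap h x) = 0.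
    have /ffunP/(_ x) := Tfg; rewrite !ffunE; rewrite /h; case: ifP => _ eq.
      by rewrite eq; ring.
    transitivity (lap f x - lap g x); last by rewrite eq subrr.
    rewrite /laplacian -sumrN -big_split; apply: eq_bigr => y _ /=; ring.
  (* At every point [h] or [lap h] vanishes, so [h] has zero energy; it is then constant, equal to
     its value 0 at [x0]. *)
  have Eh : E h h = 0.
    rewrite /dirichlet /inner big1 ?oppr0// => x _.
    by have := Th x; case: ifP => _ ->; rewrite ?mulr0 ?mul0r.
  apply/ffunP => x; have := Th x0; rewrite x0AB -(dirichlet_eq0 _ Eh x x0).
  by rewrite /h mulN1r => /eqP; rewrite subr_eq0 => /eqP.
have [e Te] := injective_linear_surjective linT injT [ffun x => (x \in B)%:R].
exists e; split=> x xAB; have /ffunP/(_ x) := Te; rewrite !ffunE !inE.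
- by rewrite xAB /= (disjointFr dAB xAB).
- by rewrite xAB orbT.
- by move: xAB; rewrite !inE negb_or => /andP[/negbTE-> /negbTE->].
Qed.

Lemma equilibriumC A B e : equilibrium A B e -> equilibrium B A (fun x => 1 - e x).
Proof.
move=> [eA eB eh]; split=> x xAB.
- by rewrite eB// subrr.
- by rewrite eA// subr0.
- rewrite -oppr0 -(eh x) 1?finset.setUC// /laplacian -sumrN.
  by apply: eq_bigr => y _; ring.
Qed.

(** Only [B] contributes: [g] vanishes on [A], and [lap e] off both sets. The weight
    [- lap e x * m x] is the equilibrium measure on [B]. *)
Lemma dirichlet_equilibrium A B e g : equilibrium A B e ->
  (forall x, x \in A -> g x = 0) ->
  E g e = \sum_(x in B) g x * (- lap e x * m x).
Proof.
move=> [eA eB eh] gA; rewrite dirichletC /dirichlet /inner -sumrN.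
rewrite [RHS]big_mkcond; apply: eq_bigr => x _.
case: ifPn => [_|xB]; first by ring.
have [xA|xA] := boolP (x \in A); first by rewrite gA// mulr0 mul0r oppr0.
by rewrite eh ?mul0r ?oppr0// !inE negb_or xA.
Qed.

Lemma dirichlet_equilibrium_cst A B e g c : equilibrium A B e ->
  (forall x, x \in A -> g x = 0) -> (forall x, x \in B -> g x = c) ->
  E g e = c * E e e.
Proof.
move=> eq gA gB; rewrite (dirichlet_equilibrium _ _ _ _ eq gA).
rewrite (dirichlet_equilibrium _ _ _ e eq); last by case: eq.
rewrite mulr_sumr; apply: eq_bigr => x xB; rewrite gB//.
by case: eq => _ -> //; rewrite mul1r.
Qed.

(** Maximum principle by energy: the excess [w] of [e] over 1 vanishes on both sets, so
    [E w w <= E w e = 0]. *)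
Lemma equilibrium_le1 A B e : equilibrium A B e -> A :|: B != finset.set0 ->
  forall x, e x <= 1.
Proof.
move=> eq /set0Pn[x0 x0AB]; have [eA eB eh] := eq.
pose w x := Num.max (e x - 1) 0.
have wA x : x \in A -> w x = 0.
  by move=> /eA ex; rewrite /w ex; apply/max_idPr; rewrite sub0r oppr_le0.
have wB x : x \in B -> w x = 0 by move=> /eB ex; rewrite /w ex subrr maxxx.
have Ew : E w w = 0.
  apply: le_anti; rewrite dirichlet_ge0 andbT -(mul0r (E e e)).
  rewrite -(dirichlet_equilibrium_cst _ _ _ _ _ eq wA wB).
  apply: le_dirichlet => x y; rewrite /w.
  by case: (leP (e x - 1) 0); case: (leP (e y - 1) 0); nra.
move=> x; have : w x = 0.
  rewrite (dirichlet_eq0 _ Ew x x0).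
  by move: x0AB; rewrite inE => /orP[/wA|/wB].
by rewrite /w => /max_idPr; rewrite subr_le0.
Qed.

(** The equilibrium measure is nonnegative, since [e] takes its maximal value 1 on [B]. *)
Lemma dirichlet_equilibrium_ge A B e g c : equilibrium A B e ->
  A :|: B != finset.set0 ->
  (forall x, x \in A -> g x = 0) -> (forall x, x \in B -> c <= g x) ->
  c * E e e <= E g e.
Proof.
move=> eq AB0 gA gB; have [eA eB eh] := eq.
rewrite !(dirichlet_equilibrium _ _ _ _ eq)// mulr_sumr.
apply: ler_sum => x xB; rewrite eB// mul1r ler_wpM2r ?gB// mulr_ge0//.
rewrite /laplacian -sumrN; apply: sumr_ge0 => y _.
by rewrite -mulrN mulr_ge0// opprB eB// subr_ge0 (equilibrium_le1 _ _ _ eq).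
Qed.

(** As [E f e = E e e], the energy of [f - e] is [E f f - E e e]. *)
Lemma equilibrium_min A B e f : equilibrium A B e ->
  (forall x, x \in A -> f x = 0) -> (forall x, x \in B -> f x = 1) ->
  E e e <= E f f.
Proof.
move=> eq fA fB.
have efE := dirichlet_equilibrium_cst _ _ _ _ _ eq fA fB.
have := dirichlet_ge0 (fun x => f x + -1 * e x); rewrite dirichletDZ efE; lra.
Qed.

(** * Capacity: symmetry, positivity, monotonicity *)

Lemma cap_equilibrium A B e : equilibrium A B e -> cap P m A B = E e e.
Proof.
move=> eq; have [eA eB _] := eq; apply: le_anti; apply/andP; split.
  apply: ge_inf; last by exists e.
  by exists 0 => _ [f _ <-]; apply: dirichlet_ge0.
apply: lb_le_inf; first by exists (E e e), e.
by move=> _ [f [fA fB] <-]; apply: equilibrium_min eq fA fB.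
Qed.

Lemma capC A B : [disjoint A & B] -> A :|: B != finset.set0 -> cap P m A B = cap P m B A.
Proof.
move=> dAB AB0; have [e eq] := equilibrium_exists _ _ dAB AB0.
rewrite (cap_equilibrium _ _ _ eq) (cap_equilibrium _ _ _ (equilibriumC _ _ _ eq)).
by apply: eq_dirichlet => x y; ring.
Qed.

Lemma cap_gt0 A B : A != finset.set0 -> B != finset.set0 -> [disjoint A & B] ->
  0 < cap P m A B.
Proof.
move=> A0 B0 dAB; have AB0 : A :|: B != finset.set0.
  by rewrite finset.setU_eq0 negb_and A0.
have [e eq] := equilibrium_exists _ _ dAB AB0.
rewrite (cap_equilibrium _ _ _ eq) lt_def dirichlet_ge0 andbT.
apply/eqP => /dirichlet_eq0 ecst; have [eA eB _] := eq.
move: A0 B0 => /set0Pn[x xA] /set0Pn[y yB].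
by have := ecst x y; rewrite eA// eB// => /esym/eqP; rewrite oner_eq0.
Qed.

Lemma cap_subset A A' B : [disjoint A' & B] -> B != finset.set0 ->
  A \subset A' -> cap P m A B <= cap P m A' B.
Proof.
move=> dAB B0 sAA'.
have dAB' : [disjoint A & B] by apply: disjointWl dAB.
have [|e eq] := equilibrium_exists _ _ dAB'.
  by rewrite finset.setU_eq0 negb_and B0 orbT.
have [|e' eq'] := equilibrium_exists _ _ dAB.
  by rewrite finset.setU_eq0 negb_and B0 orbT.
rewrite (cap_equilibrium _ _ _ eq) (cap_equilibrium _ _ _ eq').
have [eA eB _] := eq'; apply: equilibrium_min eq _ _ => // x xA.
by apply: eA; apply: (fintype.subsetP sAA').
Qed.

(** * Rayleigh quotients and the upper bound on [lambda] *)

Lemma inner_ge0 f : 0 <= inner m f f.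
Proof. by apply: sumr_ge0 => x _; rewrite mulr_ge0// -expr2 sqr_ge0. Qed.

Lemma innerZ c f : inner m (fun x => c * f x) (fun x => c * f x) = c ^+ 2 * inner m f f.
Proof. by rewrite /inner mulr_sumr; apply: eq_bigr => x _; ring. Qed.

Lemma lambda_le X f : (forall x, x \notin X -> f x = 0) -> 0 < inner m f f ->
  lambda P m X <= E f f / inner m f f.
Proof.
move=> fX f0; set c := (Num.sqrt (inner m f f))^-1.
have c2 : c ^+ 2 = (inner m f f)^-1 by rewrite exprVn sqr_sqrtr ?inner_ge0.
apply: ge_inf; first by exists 0 => _ [g _ <-]; apply: dirichlet_ge0.
exists (fun x => c * f x).
  split; last by move=> x /fX ->; rewrite mulr0.
  by rewrite /norm2 innerZ c2 mulVf ?sqrtr1// gt_eqF.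
transitivity (E (fun x => 0 + c * f x) (fun x => 0 + c * f x)).
  by apply: eq_dirichlet => x y; ring.
rewrite dirichletDZ !dirichlet0 c2; ring.
Qed.

Lemma lambda_ge X c : X != finset.set0 ->
  (forall f, (forall x, x \notin X -> f x = 0) -> c * inner m f f <= E f f) ->
  c <= lambda P m X.
Proof.
case/set0Pn => x0 x0X cX; apply: lb_le_inf; last first.
  move=> _ [f [f1 fX] <-]; rewrite -[c]mulr1.
  suff <- : inner m f f = 1 by apply: cX.
  by rewrite -(sqr_sqrtr (inner_ge0 f)) -/(norm2 m f) f1 expr1n.
(* A normalized indicator of one point shows that competitors exist; the infimum of an empty set
   would be the default 0. *)
pose d := (Num.sqrt (m x0))^-1.
pose f x := if x == x0 then d else 0.
exists (E f f), f => //; split; last first.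
  by move=> x; rewrite /f; case: eqP => // ->; rewrite x0X.
rewrite /norm2 /inner (bigD1 x0)//= big1 => [|x /negbTE x0x]; last by rewrite /f x0x !mul0r.
rewrite /f eqxx addr0 -expr2 exprVn sqr_sqrtr ?m_ge0// mulVf ?sqrtr1//.
by rewrite gt_eqF ?m_gt0.
Qed.

(* Half of the equilibrium energy is carried by each of the two truncations at
   level 1/2; this is what gives 2 instead of 4. *)
Lemma lambda_le_cap A B X e : equilibrium A B e -> B != finset.set0 ->
  (forall x, 2^-1 < e x -> x \in X) ->
  lambda P m X <= 2 * (cap P m A B / measure_of m B).
Proof.
move=> eq B0 eX; have [eA eB _] := eq.
have half0 : 0 < 2^-1 :> R by rewrite invr_gt0.
pose g x := Num.max (e x - 2^-1) 0.
have gA x : x \in A -> g x = 0.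
  by move=> /eA ex; rewrite /g ex; apply/max_idPr; lra.
have gB x : x \in B -> g x = 2^-1.
  by move=> /eB ex; rewrite /g ex max_l; lra.
have mB := measure_gt0 _ B0.
(* The factor 2 is the quotient of the 1/2 in the energy bound [Eg] by this 1/4, the square of the
   value of [g] on [B]. *)
have g_ge : 4^-1 * measure_of m B <= inner m g g.
  rewrite /measure_of mulr_sumr /inner big_mkcond; apply: ler_sum => x _.
  case: ifP => [/gB->|_]; first by lra.
  by rewrite mulr_ge0// -expr2 sqr_ge0.
have g0 : 0 < inner m g g by apply: lt_le_trans g_ge; rewrite mulr_gt0 ?invr_gt0.
have Eg : E g g <= 2^-1 * cap P m A B.
  rewrite (cap_equilibrium _ _ _ eq) -(dirichlet_equilibrium_cst _ _ _ _ _ eq gA gB).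
  apply: le_dirichlet => x y; rewrite /g.
  by case: (leP (e x - 2^-1) 0); case: (leP (e y - 2^-1) 0); nra.
have cap0 : 0 <= cap P m A B by rewrite (cap_equilibrium _ _ _ eq) dirichlet_ge0.
apply: le_trans (lambda_le X g _ g0) _.
  move=> x xX; apply/max_idPr; rewrite subr_le0 leNgt.
  by apply: contra xX => /eX.
rewrite ler_pdivrMr// mulrA mulrAC ler_pdivlMr//; nra.
Qed.

(** * The strong capacitary inequality and the lower bound on [lambda] *)

(* u is the sum of the (t_(i+1) - t_i) e_i; integrating f against the equilibrium
   measure of N_(i+1), on which f >= t_(i+1), gives the last inequality. *)
Lemma levelset_potential X f (t : nat -> R) (N : nat -> {set V}) (e : nat -> V -> R) :
  ~: X != finset.set0 -> (forall x, x \notin X -> f x = 0) ->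
  t 0%N = 0 -> (forall i, t i <= t i.+1) -> (forall i, N i.+1 \subset N i) ->
  (forall i, equilibrium (~: X) (N i.+1) (e i)) ->
  (forall i x, x \in N i.+1 -> t i.+1 <= f x) ->
  forall n, exists u,
    [/\ forall x, x \notin X -> u x = 0, forall x, x \in N n -> u x = t n,
        E u u = \sum_(i < n) (t i.+1 ^+ 2 - t i ^+ 2) * E (e i) (e i) &
        E u u <= 2 * E f u].
Proof.
move=> X0 fX t0 tS NS eq ft.
have t_ge0 i : 0 <= t i by elim: i => [|i IH]; rewrite ?t0// (le_trans IH).
have inX x : x \in ~: X -> x \notin X by rewrite inE.
elim=> [|n [u [uX uN Eu Ef]]].
  exists (fun=> 0); split=> //; first by rewrite big_ord0 dirichlet0.
  by rewrite dirichletC !dirichlet0 mulr0.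
have Eue : E u (e n) = t n * E (e n) (e n).
  apply: dirichlet_equilibrium_cst (eq n) _ _ => [x /inX /uX //|x xN].
  by apply: uN; apply: (fintype.subsetP (NS n)).
have Efe : t n.+1 * E (e n) (e n) <= E f (e n).
  apply: dirichlet_equilibrium_ge (eq n) _ _ (ft n) => [|x /inX /fX //].
  by rewrite finset.setU_eq0 negb_and X0.
have [eX eN _] := eq n.
exists (fun x => u x + (t n.+1 - t n) * e n x); split.
- by move=> x xX; rewrite uX// eX ?inE// mulr0 addr0.
- by move=> x xN; rewrite uN ?(fintype.subsetP (NS n))// eN//; ring.
- by rewrite dirichletDZ big_ord_recr /= -Eu Eue; ring.
- rewrite dirichletDZ Eue [E f _]dirichletC dirichletDZl (dirichletC u) (dirichletC (e n)).
  have := dirichlet_ge0 (e n); have := tS n; have := t_ge0 n.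
  move: Ef Efe; set a := E u u; set c := E (e n) (e n); set b := E f (e n); set d := E f u.
  set s := t n; set s' := t n.+1 => h1 h2 h3 h4 h5.
  (* Since [b >= s' * c], the step changes [E u u - 2 * E f u] by at most [- (s' - s) ^+ 2 * c]. *)
  have : (s' - s) * (s' * c) <= (s' - s) * b by rewrite ler_wpM2l// subr_ge0.
  have : 0 <= (s' - s) ^+ 2 * c by rewrite mulr_ge0 ?sqr_ge0.
  by lra.
Qed.

(** Layer-cake sums over the level sets of [f] express [inner m f f] through measures and [E u u]
    through capacities, with the same coefficients. *)
Lemma capacitary_inequality_ge0 X c f : ~: X != finset.set0 ->
  (forall A, A != finset.set0 -> A \subset X -> c * measure_of m A <= cap P m (~: X) A) ->
  (forall x, 0 <= f x) -> (forall x, x \notin X -> f x = 0) ->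
  4^-1 * c * inner m f f <= E f f.
Proof.
move=> X0 cX f0 fX.
(* The leading 0 gives zeros of [f] index 0, which keeps every [N i.+1] inside [X]. Repeated values
   are harmless: their increments vanish. *)
pose s := 0 :: sort <=%O (codom f); pose n := size (codom f).
have s_sorted : sorted <=%O s.
  rewrite /= path_sortedE; last exact: le_trans.
  rewrite sort_le_sorted andbT all_sort; apply/allP => _ /codomP[x ->]; exact: f0.
have size_s : size s = n.+1 by rewrite /= size_sort.
(* Capping the index at [n] keeps [t] monotone; past the end, [nth] would fall back to 0. *)
pose t i := nth 0 s (minn i n).
have t_mono i j : (i <= j)%N -> t i <= t j.
  move=> ij; apply: (sorted_leq_nth le_trans lexx 0 s_sorted).
  - by rewrite inE size_s ltnS geq_minr.
  - by rewrite inE size_s ltnS geq_minr.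
  - by rewrite leq_min geq_minr andbT (leq_trans (geq_minl _ _)).
pose k x := index (f x) s.
have f_s x : f x \in s by rewrite inE mem_sort codom_f orbT.
have k_le x : (k x <= n)%N by rewrite -ltnS -size_s index_mem f_s.
have t_k x : t (k x) = f x by rewrite /t (minn_idPl (k_le x)) nth_index.
have t0 : t 0%N = 0 by rewrite /t min0n.
pose N i := [set x | (i <= k x)%N].
have N_X i x : x \in N i.+1 -> x \in X.
  by rewrite inE; apply: contraLR => /fX fx; rewrite /k fx /= eqxx.
have dN i : [disjoint ~: X & N i.+1].
  by rewrite disjoint_sym finset.disjoints_subset finset.setCK; apply/fintype.subsetP/N_X.
have XN0 i : ~: X :|: N i.+1 != finset.set0 by rewrite finset.setU_eq0 negb_and X0.
have [e eq] := choice (fun i => equilibrium_exists _ _ (dN i) (XN0 i)).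
have [u [uX uN Eu Ef]] : exists u,
    [/\ forall x, x \notin X -> u x = 0, forall x, x \in N n -> u x = t n,
        E u u = \sum_(i < n) (t i.+1 ^+ 2 - t i ^+ 2) * E (e i) (e i) &
        E u u <= 2 * E f u].
  apply: levelset_potential X0 fX t0 _ _ eq _ _ => [i|i|i x].
  - exact: t_mono.
  - by apply/fintype.subsetP => x; rewrite !inE => /ltnW.
  - by rewrite inE -t_k; apply: t_mono.
(* With [E u u <= 2 * E f u], nonnegativity of the energy of [f - u / 2] gives
   [E u u <= 4 * E f f]. *)
suff : c * inner m f f <= E u u.
  by have := dirichlet_ge0 (fun x => f x + - 2^-1 * u x); rewrite dirichletDZ; lra.
(* A point [x] lies in [N i.+1] exactly when [i < k x], so its increments telescope to
   [f x ^+ 2]. *)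
have -> : inner m f f = \sum_(i < n) (t i.+1 ^+ 2 - t i ^+ 2) * measure_of m (N i.+1).
  under [RHS]eq_bigr do rewrite /measure_of big_mkcond mulr_sumr.
  rewrite exchange_big; apply: eq_bigr => x _ /=.
  transitivity ((\sum_(i < k x) (t i.+1 ^+ 2 - t i ^+ 2)) * m x).
    rewrite -(big_mkord predT (fun i => t i.+1 ^+ 2 - t i ^+ 2)).
    by rewrite (telescope_sumr (fun i => t i ^+ 2))// t0 t_k expr0n subr0 expr2.
  rewrite (big_ord_widen n (fun i => t i.+1 ^+ 2 - t i ^+ 2))// big_mkcond mulr_suml.
  by apply: eq_bigr => i _; rewrite inE; case: ifP; rewrite ?mulr0 ?mul0r.
rewrite Eu mulr_sumr; apply: ler_sum => i _; rewrite mulrCA ler_wpM2l//.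
  have tn j : t j \is Num.nneg by rewrite nnegrE -t0 t_mono.
  by rewrite subr_ge0 ler_sqr// t_mono.
have [N0|N0] := eqVneq (N i.+1) finset.set0.
  by rewrite N0 /measure_of big_set0 mulr0 dirichlet_ge0.
rewrite -(cap_equilibrium _ _ _ (eq i)) cX//; exact/fintype.subsetP/N_X.
Qed.

(** Passing to the absolute value preserves the norm and does not increase the energy. *)
Lemma capacitary_inequality X c f : ~: X != finset.set0 ->
  (forall A, A != finset.set0 -> A \subset X -> c * measure_of m A <= cap P m (~: X) A) ->
  (forall x, x \notin X -> f x = 0) ->
  4^-1 * c * inner m f f <= E f f.
Proof.
move=> X0 cX fX.
have -> : inner m f f = inner m (fun x => `|f x|) (fun x => `|f x|).
  by apply: eq_bigr => x _; rewrite -!expr2 real_normK ?num_real.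
apply: (@le_trans _ _ (E (fun x => `|f x|) (fun x => `|f x|))).
  by apply: (capacitary_inequality_ge0 X) => // x /fX ->; rewrite normr0.
apply: le_dirichlet => x y; rewrite -!expr2.
by rewrite -[leLHS]real_normK ?num_real// -[leRHS]real_normK ?num_real// ler_sqr
  ?nnegrE// ler_dist_dist.
Qed.

(** [V] has finitely many subsets, so the best constant in the capacitary hypothesis is attained by
    some [A]. *)
Lemma lambda_ge_cap X : X != finset.set0 -> ~: X != finset.set0 ->
  exists A, [/\ A != finset.set0, A \subset X &
    4^-1 * (cap P m (~: X) A / measure_of m A) <= lambda P m X].
Proof.
move=> X0 CX0.
have PX : (X != finset.set0) && (X \subset X) by rewrite X0 subxx.
have [A /andP[A0 AX] minA] :=
  arg_minP (P := fun A : {set V} => (A != finset.set0) && (A \subset X))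
    (fun A => cap P m (~: X) A / measure_of m A) PX.
exists A; split=> //; apply: lambda_ge => // f fX.
apply: (capacitary_inequality X) => // B B0 BX.
by rewrite -ler_pdivlMr ?measure_gt0// minA// B0.
Qed.

(** Monotonicity of [logmean] is stated for positive arguments, hence this strict bound. *)
Lemma lambda_gt0 X : X != finset.set0 -> ~: X != finset.set0 -> 0 < lambda P m X.
Proof.
move=> X0 CX0; have [A [A0 AX]] := lambda_ge_cap _ X0 CX0; apply: lt_le_trans.
rewrite mulr_gt0 ?invr_gt0// divr_gt0 ?measure_gt0// cap_gt0//.
by rewrite disjoint_sym finset.disjoints_subset finset.setCK.
Qed.

(** * Comparison of the two infima *)

Lemma cap_theta_ge0 : lbound (cap_theta_values P m) 0.
Proof.
move=> _ [A [B [A0 B0 dAB ->]]].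
by rewrite logmean_ge0// divr_gt0 ?measure_gt0 ?cap_gt0.
Qed.

Lemma spectral_theta_ge0 : lbound (spectral_theta_values P m) 0.
Proof.
move=> _ [X [X0 XT ->]].
have CX0 : ~: X != finset.set0 by rewrite setC_eq0.
by rewrite logmean_ge0// lambda_gt0// finset.setCK.
Qed.

Lemma quarter_cap_theta_le X : X != finset.set0 -> X != finset.setT ->
  4^-1 * alpha_cap_theta P m <= logmean (lambda P m X) (lambda P m (~: X)).
Proof.
move=> X0 XT; have CX0 : ~: X != finset.set0 by rewrite setC_eq0.
have [A [A0 AX lamA]] := lambda_ge_cap _ X0 CX0.
have := lambda_ge_cap (~: X); rewrite finset.setCK => /(_ CX0 X0)[B [B0 BX lamB]].
have dXB : [disjoint X & B] by rewrite disjoint_sym finset.disjoints_subset.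
have dCXA : [disjoint ~: X & A].
  by rewrite disjoint_sym finset.disjoints_subset finset.setCK.
have dAB : [disjoint A & B] by apply: disjointWl dXB.
(* After exchanging the two plates, [B] is enlarged to [~: X]. *)
have cA : cap P m A B <= cap P m (~: X) A.
  by rewrite capC ?cap_subset// finset.setU_eq0 negb_and A0.
have cB : cap P m A B <= cap P m X B by rewrite cap_subset.
have mA := measure_gt0 _ A0; have mB := measure_gt0 _ B0.
have c0 := cap_gt0 _ _ A0 B0 dAB.
apply: (@le_trans _ _
  (4^-1 * logmean (cap P m A B / measure_of m A) (cap P m A B / measure_of m B))).
  rewrite ler_pM2l ?invr_gt0//; apply: ge_inf; first by exists 0; apply: cap_theta_ge0.
  by exists A, B.
rewrite -logmeanZ ?invr_gt0 ?divr_gt0//.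
apply: logmean_mono; rewrite ?mulr_gt0 ?invr_gt0//.
- by apply: le_trans lamA; rewrite ler_pM2l ?invr_gt0// ler_pM2r ?invr_gt0.
- by apply: le_trans lamB; rewrite ler_pM2l ?invr_gt0// ler_pM2r ?invr_gt0.
Qed.

Lemma half_spectral_theta_le A B : A != finset.set0 -> B != finset.set0 ->
  [disjoint A & B] ->
  2^-1 * alpha_spectral P m <=
    logmean (cap P m A B / measure_of m A) (cap P m A B / measure_of m B).
Proof.
move=> A0 B0 dAB.
have AB0 : A :|: B != finset.set0 by rewrite finset.setU_eq0 negb_and A0.
have [e eq] := equilibrium_exists _ _ dAB AB0; have [eA eB _] := eq.
(* The level 1/2 itself may go to either side: [lambda_le_cap] asks only that points strictly above
   1/2, for [e] or for [1 - e], lie in the right set. *)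
pose X := [set x | e x <= 2^-1].
have X0 : X != finset.set0.
  by case/set0Pn: A0 => x /eA ex; apply/set0Pn; exists x; rewrite inE ex; lra.
have CX0 : ~: X != finset.set0.
  case/set0Pn: B0 => x /eB ex; apply/set0Pn; exists x.
  by rewrite !inE ex -ltNge; lra.
have mA := measure_gt0 _ A0; have mB := measure_gt0 _ B0.
have c0 := cap_gt0 _ _ A0 B0 dAB.
rewrite mulrC ler_pdivrMr// mulrC -logmeanZ ?divr_gt0//.
apply: (@le_trans _ _ (logmean (lambda P m X) (lambda P m (~: X)))).
  apply: ge_inf; first by exists 0; apply: spectral_theta_ge0.
  by exists X; split=> //; rewrite -setC_eq0.
apply: logmean_mono; rewrite ?lambda_gt0 ?finset.setCK//.
- rewrite capC//; apply: lambda_le_cap (equilibriumC _ _ _ eq) A0 _ => x ex.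
  by rewrite inE; lra.
- by apply: lambda_le_cap eq B0 _ => x ex; rewrite !inE -ltNge.
Qed.

End Chain.

Theorem theorem3p3 (R : realType) (V : finType) (P : V -> V -> R) (m : V -> R)
  (P_ge0 : forall x y, 0 <= P x y)
  (P_symsupp : forall x y, (0 < P x y) = (0 < P y x))
  (P_conn : forall x y, connect (fun u v => 0 < P u v) x y)
  (m_ge0 : forall x, 0 <= m x)
  (m_prob : \sum_(x : V) m x = 1)
  (m_rev : forall x y, m x * P x y = m y * P y x) :
  (1 / 4) * alpha_cap_theta P m <= alpha_spectral P m /\
  alpha_spectral P m <= 2 * alpha_cap_theta P m.
Proof.
(* If V is a point, both infima are over the empty set and equal 0. *)
have [|noX] := pselect (exists X : {set V}, X != finset.set0 /\ X != finset.setT); last first.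
  have spec0 : spectral_theta_values P m = set0.
    by apply/seteqP; split=> // t [X [X0 XT _]]; apply: noX; exists X.
  have cap0 : cap_theta_values P m = set0.
    apply/seteqP; split=> // t [A [B [A0 B0 dAB _]]]; apply: noX; exists A; split=> //.
    apply: contraNneq B0 => AT; move: dAB.
    by rewrite AT disjoint_sym finset.disjoints_subset finset.setCT finset.subset0.
  by rewrite /alpha_cap_theta /alpha_spectral spec0 cap0 inf0 !mulr0.
move=> [X [X0 XT]]; split.
  rewrite div1r; apply: lb_le_inf; first by exists (logmean (lambda P m X) (lambda P m (~: X))), X.
  by move=> _ [Y [Y0 YT ->]]; apply: quarter_cap_theta_le.
rewrite -ler_pdivrMl//; apply: lb_le_inf.
  exists (logmean (cap P m X (~: X) / measure_of m X)
                  (cap P m X (~: X) / measure_of m (~: X))), X, (~: X).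
  by split=> //; rewrite ?setC_eq0// finset.disjoints_subset finset.setCK.
by move=> _ [A [B [A0 B0 dAB ->]]]; apply: half_spectral_theta_le.
Qed.
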